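(* Let $N\ge3$. For a subspace $X\subset S^{N-1}_{\mathbb R,+}$ let $G(X)=(G_k(X))_k$ with $G_k(X)=\{\sigma\in S_k:\ \text{the relations }\mathcal R_\sigma\text{ hold in }C(X)\}$ and $H(X)=(H_k(X))_k$ with $H_k(X)=\{\sigma\in S_k:\ \text{the relations }\bar{\mathcal R}_\sigma\text{ hold in }C(X)\}$. Then: (i) $G(X)=S_\infty$ for $X\in\{S^{N-1}_{\mathbb R},S^{N-1,1}_{\mathbb R},S^{N-1,0}_{\mathbb R}\}$; $G(X)=S_\infty^*$ for $X\in\{S^{N-1}_{\mathbb R,*},S^{N-1,1}_{\mathbb R,*},\bar S^{N-1,1}_{\mathbb R}\}$; $G(X)=\{1\}$ for $X\in\{S^{N-1}_{\mathbb R,+},\bar S^{N-1}_{\mathbb R,*},\bar S^{N-1}_{\mathbb R}\}$. (ii) $H(X)=\{1\}$ for $X\in\{S^{N-1}_{\mathbb R},S^{N-1}_{\mathbb R,*},S^{N-1}_{\mathbb R,+}\}$; $H(X)=S_\infty^*$ for $X\in\{S^{N-1,1}_{\mathbb R},S^{N-1,1}_{\mathbb R,*},\bar S^{N-1}_{\mathbb R,*}\}$; $H(X)=S_\infty$ for $X\in\{S^{N-1,0}_{\mathbb R},\bar S^{N-1,1}_{\mathbb R},\bar S^{N-1}_{\mathbb R}\}$. In particular each of these nine spheres equals $S^{N-1}_{\mathbb R,G(X)}\cap\bar S^{N-1}_{\mathbb R,H(X)}$.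
   Context: $C(S^{N-1}_{\mathbb R,+})$ denotes the universal $C^*$-algebra generated by self-adjoint elements $x_1,\dots,x_N$ subject to $\sum_i x_i^2=1$. A noncommutative subspace $X\subset S^{N-1}_{\mathbb R,+}$ is given by a quotient $C(X)$ of $C(S^{N-1}_{\mathbb R,+})$ by relations among the standard coordinates $x_i$; $X\cap Y$ is obtained by imposing both sets of relations. Subspheres: $S^{N-1}_{\mathbb R}$: $x_ix_j=x_jx_i$ for all $i,j$; $\bar S^{N-1}_{\mathbb R}$: $x_ix_j=-x_jx_i$ for all $i\ne j$; $S^{N-1}_{\mathbb R,*}$: $x_ix_jx_k=x_kx_jx_i$ for all $i,j,k$; $\bar S^{N-1}_{\mathbb R,*}$: $x_ix_jx_k=-x_kx_jx_i$ for $i,j,k$ pairwise distinct and $x_ix_jx_k=x_kx_jx_i$ otherwise. For $d\in\{1,\dots,N\}$, the polygonal versions $S^{N-1,d-1}_{\mathbb R}$, $\bar S^{N-1,d-1}_{\mathbb R}$, $S^{N-1,d-1}_{\mathbb R,*}$, $\bar S^{N-1,d-1}_{\mathbb R,*}$, $S^{N-1,d-1}_{\mathbb R,+}$ are obtained from the corresponding sphere by additionally imposing $x_{i_0}x_{i_1}\cdots x_{i_d}=0$ for all pairwise distinct $i_0,\dots,i_d$. Relations from permutations: for $\sigma\in S_k$ and indices $i_1,\dots,i_k\in\{1,\dots,N\}$ let $\varepsilon_\sigma(i)=(-1)^{m}$, where $m$ is the number of pairs $r<s$ with $\sigma(r)>\sigma(s)$ and $i_{\sigma(r)}\ne i_{\sigma(s)}$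 (this is the signature $\varepsilon$ of the even partition $\ker\binom{i_1\ \dots\ i_k}{i_{\sigma(1)}\dots i_{\sigma(k)}}$, i.e. the sign with which $x_{i_1}\cdots x_{i_k}=\pm x_{i_{\sigma(1)}}\cdots x_{i_{\sigma(k)}}$ for pairwise anticommuting variables). The untwisted relations $\mathcal R_\sigma$ are $x_{i_1}\cdots x_{i_k}=x_{i_{\sigma(1)}}\cdots x_{i_{\sigma(k)}}$ for all $i_1,\dots,i_k$; the twisted relations $\bar{\mathcal R}_\sigma$ are $x_{i_1}\cdots x_{i_k}=\varepsilon_\sigma(i)\,x_{i_{\sigma(1)}}\cdots x_{i_{\sigma(k)}}$ for all $i_1,\dots,i_k$. For $E\subset\bigcup_kS_k$, $S^{N-1}_{\mathbb R,E}$ (resp. $\bar S^{N-1}_{\mathbb R,E}$) is the subsphere of $S^{N-1}_{\mathbb R,+}$ defined by the relations $\mathcal R_\sigma$ (resp. $\bar{\mathcal R}_\sigma$), $\sigma\in E$. Filtered groups: a family $G=(G_k)_{k\ge0}$ of subgroups $G_k\subset S_k$ with $\sigma\otimes\tau\in G_{k+l}$ for $\sigma\in G_k,\tau\in G_l$ ($\sigma\otimes\tau$ acts as $\sigma$ on $\{1..k\}$ and as $\tau$ shifted by $k$ on $\{k+1..k+l\}$). $S_\infty=(S_k)$, $\{1\}=(\{1_k\})$, and $S_\infty^*=(S_k^* )$ with $S_k^*=\{\sigma\in S_k:\sigma(r)\equiv r \bmod 2\ \forall r\}$, so $S_{2n}^*\simeq S_n\times S_n$, $S_{2n+1}^*\simeq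 S_n\times S_{n+1}$. *)

(* Defs.v *)
From Stdlib Require Import Reals.
From mathcomp Require Import all_boot all_fingroup.

Set Implicit Arguments.
Unset Strict Implicit.
Unset Printing Implicit Defensive.

Definition Cplx : Type := (R * R)%type.
Definition Cadd (c d : Cplx) : Cplx := (Rplus c.1 d.1, Rplus c.2 d.2).
Definition Cmul (c d : Cplx) : Cplx :=
  (Rminus (Rmult c.1 d.1) (Rmult c.2 d.2), Rplus (Rmult c.1 d.2) (Rmult c.2 d.1)).
Definition Cconj (c : Cplx) : Cplx := (c.1, Ropp c.2).
Definition Cone : Cplx := (R1, R0).
Definition Cmod (c : Cplx) : R := sqrt (Rplus (Rmult c.1 c.1) (Rmult c.2 c.2)).

Record CStarAlgebra := {
  ca_car :> Type;
  ca_zero : ca_car;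
  ca_one : ca_car;
  ca_add : ca_car -> ca_car -> ca_car;
  ca_opp : ca_car -> ca_car;
  ca_mul : ca_car -> ca_car -> ca_car;
  ca_scal : Cplx -> ca_car -> ca_car;
  ca_star : ca_car -> ca_car;
  ca_norm : ca_car -> R;
  ca_addA : forall a b c, ca_add a (ca_add b c) = ca_add (ca_add a b) c;
  ca_addC : forall a b, ca_add a b = ca_add b a;
  ca_add0 : forall a, ca_add ca_zero a = a;
  ca_addN : forall a, ca_add (ca_opp a) a = ca_zero;
  ca_scalA : forall c d a, ca_scal c (ca_scal d a) = ca_scal (Cmul c d) a;
  ca_scal1 : forall a, ca_scal Cone a = a;
  ca_scalDl : forall c d a, ca_scal (Cadd c d) a = ca_add (ca_scal c a) (ca_scal d a);
  ca_scalDr : forall c a b, ca_scal c (ca_add a b) = ca_add (ca_scal c a) (ca_scal c b);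
  ca_mulA : forall a b c, ca_mul a (ca_mul b c) = ca_mul (ca_mul a b) c;
  ca_mul1l : forall a, ca_mul ca_one a = a;
  ca_mul1r : forall a, ca_mul a ca_one = a;
  ca_mulDl : forall a b c, ca_mul (ca_add a b) c = ca_add (ca_mul a c) (ca_mul b c);
  ca_mulDr : forall a b c, ca_mul a (ca_add b c) = ca_add (ca_mul a b) (ca_mul a c);
  ca_scal_mull : forall c a b, ca_mul (ca_scal c a) b = ca_scal c (ca_mul a b);
  ca_scal_mulr : forall c a b, ca_mul a (ca_scal c b) = ca_scal c (ca_mul a b);
  ca_starK : forall a, ca_star (ca_star a) = a;
  ca_starD : forall a b, ca_star (ca_add a b) = ca_add (ca_star a) (ca_star b);
  ca_starZ : forall c a, ca_star (ca_scal c a) = ca_scal (Cconj c) (ca_star a);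
  ca_starM : forall a b, ca_star (ca_mul a b) = ca_mul (ca_star b) (ca_star a);
  ca_norm_eq0 : forall a, ca_norm a = R0 -> a = ca_zero;
  ca_normD : forall a b, Rle (ca_norm (ca_add a b)) (Rplus (ca_norm a) (ca_norm b));
  ca_normZ : forall c a, ca_norm (ca_scal c a) = Rmult (Cmod c) (ca_norm a);
  ca_normM : forall a b, Rle (ca_norm (ca_mul a b)) (Rmult (ca_norm a) (ca_norm b));
  ca_cstar : forall a, ca_norm (ca_mul (ca_star a) a) = Rmult (ca_norm a) (ca_norm a);
  ca_complete : forall u : nat -> ca_car,
    (forall eps, Rlt R0 eps -> exists n0, forall m n, (n0 <= m)%N -> (n0 <= n)%N ->
        Rlt (ca_norm (ca_add (u m) (ca_opp (u n)))) eps) ->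
    exists l, forall eps, Rlt R0 eps -> exists n0, forall n, (n0 <= n)%N ->
        Rlt (ca_norm (ca_add (u n) (ca_opp l))) eps
}.

Arguments ca_zero {_}.
Arguments ca_one {_}.

Section Words.
Variables (N : nat) (A : CStarAlgebra) (x : 'I_N -> A).

Definition mono (w : seq 'I_N) : A := foldr (fun i acc => ca_mul (x i) acc) ca_one (map id w).

Definition sumsq : A := foldr (fun i acc => ca_add (ca_mul (x i) (x i)) acc) ca_zero (enum 'I_N).

Definition word k (i : 'I_k -> 'I_N) : seq 'I_N := [seq i r | r <- enum 'I_k].
Definition word_perm k (s : 'S_k) (i : 'I_k -> 'I_N) : seq 'I_N := [seq i (s r) | r <- enum 'I_k].

Definition eps_count k (s : 'S_k) (i : 'I_k -> 'I_N) : nat :=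
  #|[pred rs : 'I_k * 'I_k | [&& (rs.1 < rs.2)%N, (s rs.2 < s rs.1)%N & i (s rs.1) != i (s rs.2)]]|.

Definition Rrel k (s : 'S_k) : Prop :=
  forall i : 'I_k -> 'I_N, mono (word i) = mono (word_perm s i).

Definition barRrel k (s : 'S_k) : Prop :=
  forall i : 'I_k -> 'I_N,
    mono (word i) = (if odd (eps_count s i) then ca_opp (mono (word_perm s i))
                     else mono (word_perm s i)).

Definition sphereP : Prop := (forall i, ca_star (x i) = x i) /\ sumsq = ca_one.

Definition commP : Prop := forall i j, ca_mul (x i) (x j) = ca_mul (x j) (x i).
Definition acommP : Prop :=
  forall i j, i != j -> ca_mul (x i) (x j) = ca_opp (ca_mul (x j) (x i)).
Definition hcommP : Prop := forall i j k, mono [:: i; j; k] = mono [:: k; j; i].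
Definition bhcommP : Prop := forall i j k,
  if [&& i != j, j != k & i != k] then mono [:: i; j; k] = ca_opp (mono [:: k; j; i])
  else mono [:: i; j; k] = mono [:: k; j; i].
Definition polyP (d : nat) : Prop :=
  forall i : 'I_d.+1 -> 'I_N, injective i -> mono (word i) = ca_zero.

End Words.

Unset Implicit Arguments.

(* Noncommutative subspaces of S^{N-1}_{R,+}: described by the class   *)
(* of all representations (tuples x in unital C*-algebras satisfying   *)
(* the relations), i.e. by the universal property of C(X).             *)
Definition subspace (N : nat) := forall A : CStarAlgebra, ('I_N -> A) -> Prop.

Definition S_plus N : subspace N := fun A x => sphereP x.
Definition S_R N : subspace N := fun A x => sphereP x /\ commP x.
Definition Sbar_R N : subspace N := fun A x => sphereP x /\ acommP x.
Definition S_star N : subspace N := fun A x => sphereP x /\ hcommP x.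
Definition Sbar_star N : subspace N := fun A x => sphereP x /\ bhcommP x.
(* polygonal versions S^{N-1,d-1} *)
Definition S_R_poly N d : subspace N := fun A x => S_R N A x /\ polyP x d.
Definition Sbar_R_poly N d : subspace N := fun A x => Sbar_R N A x /\ polyP x d.
Definition S_star_poly N d : subspace N := fun A x => S_star N A x /\ polyP x d.

Definition Gfam N (X : subspace N) k (s : 'S_k) : Prop :=
  forall (A : CStarAlgebra) (x : 'I_N -> A), X A x -> Rrel x s.
Definition Hfam N (X : subspace N) k (s : 'S_k) : Prop :=
  forall (A : CStarAlgebra) (x : 'I_N -> A), X A x -> barRrel x s.

Definition permfam := forall k, 'S_k -> Prop.
Definition S_E N (E : permfam) : subspace N :=
  fun A x => sphereP x /\ (forall k (s : 'S_k), E k s -> Rrel x s).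
Definition Sbar_E N (E : permfam) : subspace N :=
  fun A x => sphereP x /\ (forall k (s : 'S_k), E k s -> barRrel x s).
Definition cap_sub N (X Y : subspace N) : subspace N := fun A x => X A x /\ Y A x.
Definition sub_eq N (X Y : subspace N) : Prop := forall A x, X A x <-> Y A x.

Definition S_infty : permfam := fun k s => True.
Definition S_infty_star : permfam := fun k s => forall r : 'I_k, odd (s r) = odd r.
Definition triv_fam : permfam := fun k s => s = 1%g.

Inductive sph :=
 | sR | sR1 | sR0 | sStar | sStar1 | sBar1 | sPlus | sBarStar | sBar.

Definition sph_space N (s : sph) : subspace N :=
  match s with
  | sR => S_R N            | sR1 => S_R_poly N 2     | sR0 => S_R_poly N 1
  | sStar => S_star N      | sStar1 => S_star_poly N 2 | sBar1 => Sbar_R_poly N 2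
  | sPlus => S_plus N      | sBarStar => Sbar_star N | sBar => Sbar_R N
  end.

Definition expG (s : sph) : permfam :=
  match s with
  | sR | sR1 | sR0 => S_infty
  | sStar | sStar1 | sBar1 => S_infty_star
  | sPlus | sBarStar | sBar => triv_fam
  end.

Definition expH (s : sph) : permfam :=
  match s with
  | sR | sStar | sPlus => triv_fam
  | sR1 | sStar1 | sBarStar => S_infty_star
  | sR0 | sBar1 | sBar => S_infty
  end.

(* Main.v *)
(** Write a permuted monomial as a word. Moving a letter past one neighbour
    (commutation or anticommutation), or past two (half-commutation), sorts any
    permutation, respectively any permutation preserving the parity of
    positions, and the sign picked up is the number of inversions between
    different letters. This gives all the relations which hold.

    For the converse, three anticommuting multiples of Pauli matrices have
    invertible monomials and satisfy every twisted relation, so an untwisted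
    relation R_sigma on them forces every sign eps_sigma(i) to be +1; three equal
    scalars do the same for the twisted relations. A word with one letter
    different from the others has sign (-1)^(sigma(r) - r), so two letters already
    force sigma to preserve parity. With three letters, the signs of the words
    marking r, marking r', and marking both multiply to -1 exactly when sigma
    inverts r and r', hence sigma has no inversion and is the identity.

    The equality of each sphere with the intersection is then a matter of
    combining (anti)commutation and half-commutation: x y = y x = - x y gives
    x y = 0, and similarly for words of length three. *)
Require Import Defs.
From Stdlib Require Import Reals Lra Classical.
From mathcomp Require Import all_boot all_fingroup.

Set Implicit Arguments.
Unset Strict Implicit.
Unset Printing Implicit Defensive.

(** * Permuting the letters of a word *)

Section CStarArithmetic.
Variable A : CStarAlgebra.
Implicit Types a b c : A.

Lemma ca_addI a b c : ca_add a b = ca_add a c -> b = c.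
Proof.
by move=> e; rewrite -(ca_add0 b) -(ca_add0 c) -(ca_addN a) -!ca_addA e.
Qed.

Lemma ca_addr0 a : ca_add a ca_zero = a.
Proof. by rewrite ca_addC ca_add0. Qed.

Lemma ca_addrN a : ca_add a (ca_opp a) = ca_zero.
Proof. by rewrite ca_addC ca_addN. Qed.

Lemma ca_oppK a : ca_opp (ca_opp a) = a.
Proof. by apply: (@ca_addI (ca_opp a)); rewrite ca_addrN ca_addN. Qed.

Lemma ca_opp0 : ca_opp ca_zero = ca_zero :> A.
Proof. by rewrite -[LHS]ca_add0 ca_addrN. Qed.

Lemma ca_mulr0 a : ca_mul a ca_zero = ca_zero.
Proof.
by apply: (@ca_addI (ca_mul a ca_zero)); rewrite -ca_mulDr ca_add0 ca_addr0.
Qed.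

Lemma ca_mul0r a : ca_mul ca_zero a = ca_zero.
Proof.
by apply: (@ca_addI (ca_mul ca_zero a)); rewrite -ca_mulDl ca_add0 ca_addr0.
Qed.

Lemma ca_mulrN a b : ca_mul a (ca_opp b) = ca_opp (ca_mul a b).
Proof.
by apply: (@ca_addI (ca_mul a b)); rewrite -ca_mulDr !ca_addrN ca_mulr0.
Qed.

Lemma ca_mulNr a b : ca_mul (ca_opp a) b = ca_opp (ca_mul a b).
Proof.
by apply: (@ca_addI (ca_mul a b)); rewrite -ca_mulDl !ca_addrN ca_mul0r.
Qed.

(** Adding [a] gives [a + a = 0], and scaling by 1/2 recovers [a]. *)
Lemma ca_eqN0 a : a = ca_opp a -> a = ca_zero.
Proof.
move=> e; have h : ca_add a a = ca_zero by rewrite {2}e ca_addrN.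
have z : ca_scal (Rinv 2, R0) (ca_zero : A) = ca_zero.
  by apply: (@ca_addI (ca_scal (Rinv 2, R0) ca_zero));
     rewrite -ca_scalDr ca_add0 ca_addr0.
rewrite -z -h ca_scalDr -ca_scalDl -[LHS]ca_scal1; congr ca_scal.
by rewrite /Cadd /Cone /=; congr pair; field.
Qed.

(** Boolean signs compose by [addb], so one argument serves the twisted and the untwisted
    relations. *)
Definition signed (b : bool) a : A := if b then ca_opp a else a.

Lemma signed_addb (b c : bool) a : signed b (signed c a) = signed (b (+) c) a.
Proof. by case: b; case: c => //=; rewrite ca_oppK. Qed.

Lemma signed_mulr (b : bool) a c : ca_mul a (signed b c) = signed b (ca_mul a c).
Proof. by case: b => //=; rewrite ca_mulrN. Qed.

Lemma signed_mull (b : bool) a c : ca_mul (signed b a) c = signed b (ca_mul a c).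
Proof. by case: b => //=; rewrite ca_mulNr. Qed.

Lemma signed_scal (b : bool) z a : ca_scal z (signed b a) = signed b (ca_scal z a).
Proof.
by rewrite -[X in ca_scal z X]ca_mul1l -ca_scal_mull signed_mulr ca_scal_mull ca_mul1l.
Qed.

Lemma signed0 (b : bool) : signed b ca_zero = ca_zero.
Proof. by case: b => //=; rewrite ca_opp0. Qed.

Lemma signed_inj_sign (b c : bool) a : signed b a = signed c a -> a <> ca_zero -> b = c.
Proof.
case: b; case: c => //= e ne; case: ne; first by apply: ca_eqN0.
by apply: ca_eqN0; rewrite -e.
Qed.

End CStarArithmetic.

Section TwistedInversions.
Variables (N k : nat) (i : 'I_k -> 'I_N).
Implicit Types (a b c : 'I_k) (l m : seq 'I_k).

(** Lists hold positions rather than letters, so that entries stay distinct when letters repeat; an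
    inverted pair counts only if its letters differ. *)
Definition twinv a b : bool := (b < a)%N && (i a != i b).

Fixpoint invs l : nat :=
  if l is a :: l' then count (twinv a) l' + invs l' else 0.

Lemma twinv_sym a b : a != b -> twinv a b (+) twinv b a = (i a != i b).
Proof.
by rewrite /twinv (eq_sym (i b)) neq_ltn; case: ltngtP; case: (i a != i b).
Qed.

Lemma odd_invs_swap a b l : a != b ->
  odd (invs [:: a, b & l]) = odd (invs [:: b, a & l]) (+) (i a != i b).
Proof.
by move=> /twinv_sym <- /=; rewrite !oddD !oddb; case: twinv; case: twinv; do 3!case: odd.
Qed.

(** Only the three pairs inside the block change order; [twinv_sym] gives the parity of each
    change. *)
Lemma odd_invs_swap3 a b c l : a != b -> b != c -> a != c ->
  odd (invs [:: a, b, c & l]) = odd (invs [:: c, b, a & l])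
     (+) ((i a != i b) (+) (i b != i c) (+) (i a != i c)).
Proof.
move=> /twinv_sym <- /twinv_sym <- /twinv_sym <- /=; rewrite !oddD !oddb.
by do 6!case: twinv; do 4!case: odd.
Qed.

(** The inversions between [a] and its tail depend only on the multiset of the tail, so they
    cancel. *)
Lemma odd_invs_cons a l m : perm_eq l m ->
  odd (invs (a :: l)) (+) odd (invs (a :: m)) = odd (invs l) (+) odd (invs m).
Proof.
move=> /seq.permP/(_ (twinv a)) /= ->.
by rewrite !oddD; do 3!case: odd.
Qed.

Lemma eps_count_invs (s : 'S_k) : eps_count s i = invs [seq s r | r <- enum 'I_k].
Proof.
pose F (r1 r2 : 'I_k) : bool := (r1 < r2)%N && twinv (s r1) (s r2).
(* Along an increasing list, [r1 < r2] says that [r1] stands first, which is the order used by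
   [invs]. *)
have invs_sum (l : seq 'I_k) : sorted (relpre val ltn) l ->
    invs [seq s r | r <- l] = \sum_(r1 <- l) \sum_(r2 <- l) F r1 r2.
  elim: l => [|a l IH] /= pl; first by rewrite big_nil.
  have ltl : all (fun b => a < b)%N l by apply: order_path_min pl => ? ? ?; apply: ltn_trans.
  rewrite IH ?(path_sorted pl) // big_cons; congr (_ + _).
    rewrite big_cons {1}/F ltnn add0n count_map -sum1_count big_mkcond /=.
    by rewrite !big_seq; apply: eq_bigr => b /(allP ltl) ab; rewrite /F ab.
  rewrite !big_seq; apply: eq_bigr => b /(allP ltl) ab; rewrite big_cons.
  by rewrite {2}/F ltnNge ltnW.
rewrite invs_sum; last first.
  by rewrite -sorted_map val_enum_ord iota_ltn_sorted.
rewrite /eps_count -sum1_card big_mkcond /= big_enum /=.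
under [RHS]eq_bigr => r1 _ do rewrite big_enum /=.
by rewrite pair_bigA /=; apply: eq_bigr => -[r1 r2] _.
Qed.

Lemma eps_count1 : eps_count 1%g i = 0.
Proof.
apply: eq_card0 => -[r1 r2]; rewrite !inE /= !perm1.
by apply/and3P => -[/ltnW]; rewrite leqNgt => /negP.
Qed.

End TwistedInversions.

Fixpoint evens {T} (l : seq T) : seq T := if l is a :: l' then a :: odds l' else [::]
with odds {T} (l : seq T) : seq T := if l is a :: l' then evens l' else [::].

Lemma perm_evens_odds {T : eqType} (l : seq T) : perm_eq l (evens l ++ odds l).
Proof.
elim: l => //= a l IH; rewrite perm_cons.
by apply: perm_trans IH _; rewrite perm_catC.
Qed.

Lemma mono_cons N (A : CStarAlgebra) (x : 'I_N -> A) j w :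
  mono x (j :: w) = ca_mul (x j) (mono x w).
Proof. by []. Qed.

(* [tw] selects the twisted relations. *)
Section Reordering.
Variables (N : nat) (A : CStarAlgebra) (x : 'I_N -> A) (tw : bool).

Definition scommP : Prop := forall i j,
  ca_mul (x i) (x j) = signed (tw && (i != j)) (ca_mul (x j) (x i)).

(** The parity form is what reversing three letters produces; it is true exactly for pairwise
    distinct letters ([distinct3]). *)
Definition shcommP : Prop := forall i j k,
  mono x [:: i; j; k] =
  signed (tw && ((i != j) (+) (j != k) (+) (i != k))) (mono x [:: k; j; i]).

Definition sRrel k (s : 'S_k) : Prop := forall i : 'I_k -> 'I_N,
  mono x (word i) = signed (tw && odd (eps_count s i)) (mono x (word_perm s i)).

Section Words.
Variables (k : nat) (i : 'I_k -> 'I_N).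
Implicit Types (a b c : 'I_k) (l m : seq 'I_k).

(** The rearrangement is carried along with the sign: prefixing a letter preserves the signed
    equality because the tails are rearrangements of each other. *)
Definition sorts_to l m : Prop := perm_eq l m /\
  mono x (map i l) =
  signed (tw && (odd (invs i l) (+) odd (invs i m))) (mono x (map i m)).

Lemma sorts_to_refl l : sorts_to l l.
Proof. by split; rewrite // addbb andbF. Qed.

Lemma sorts_to_trans m l n : sorts_to l m -> sorts_to m n -> sorts_to l n.
Proof.
move=> [p1 e1] [p2 e2]; split; first exact: perm_trans p1 p2.
rewrite e1 e2 signed_addb; congr signed.
by case: tw => //=; do 3!case: odd.
Qed.

Lemma sorts_to_cons a l m : sorts_to l m -> sorts_to (a :: l) (a :: m).
Proof.
move=> [p e]; split; first by rewrite perm_cons.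
by rewrite odd_invs_cons // !map_cons !mono_cons e signed_mulr.
Qed.

Lemma sorts_to_swap a b l : scommP -> a != b -> sorts_to [:: a, b & l] [:: b, a & l].
Proof.
move=> sc ab; split; first by rewrite (perm_catCA [:: a] [:: b] l).
rewrite odd_invs_swap // addbAC addbb addFb !map_cons !mono_cons.
by rewrite ca_mulA sc signed_mull ca_mulA.
Qed.

Lemma sorts_to_swap3 a b c l : shcommP -> uniq [:: a, b, c & l] ->
  sorts_to [:: a, b, c & l] [:: c, b, a & l].
Proof.
move=> sc /=; rewrite !inE !negb_or => /and3P[/and3P[ab ac _] /andP[bc _] _].
split.
  by rewrite (perm_catCA [:: a; b] [:: c] l) perm_cons (perm_catCA [:: a] [:: b] l).
rewrite odd_invs_swap3 // addbAC addbb addFb !map_cons !mono_cons.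
have := sc (i a) (i b) (i c); rewrite /mono /= !ca_mul1r => e.
by rewrite !ca_mulA -[ca_mul (ca_mul (x (i a)) _) _]ca_mulA e signed_mull !ca_mulA.
Qed.

(** Bubbles [a] to the front past one neighbour at a time. *)
Lemma sorts_to_head a l : scommP -> uniq l -> a \in l ->
  exists m, sorts_to l (a :: m).
Proof.
move=> sc; elim: l => //= b l IH /andP[bl ul].
case: (eqVneq a b) => [<- _|ab]; first by exists l; apply: sorts_to_refl.
rewrite inE (negPf ab) => /(IH ul)[m e]; exists (b :: m).
by apply: (sorts_to_trans (sorts_to_cons b e)); apply: sorts_to_swap; rewrite // eq_sym.
Qed.

(** Selection sort: bring the first letter of [m] to the front of [l], then sort the rest. *)
Lemma perm_sorts_to l m : scommP -> uniq l -> perm_eq l m -> sorts_to l m.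
Proof.
move=> sc; elim: m l => [|a m IH] l ul lm.
  by rewrite (perm_nilP lm); apply: sorts_to_refl.
have [|n e] := @sorts_to_head a l sc ul; first by rewrite (perm_mem lm) mem_head.
apply: (sorts_to_trans e); apply: sorts_to_cons.
have := perm_uniq e.1; rewrite ul => /esym/andP[_ un]; apply: IH => //.
by rewrite -(perm_cons a); apply: perm_trans lm; rewrite perm_sym; case: e.
Qed.

(* Jumping over two letters keeps each letter on positions of a fixed parity. *)
Lemma sorts_to_head2 a l : shcommP -> uniq l -> a \in evens l ->
  exists m, [/\ sorts_to l (a :: m), perm_eq (evens l) (evens (a :: m))
              & perm_eq (odds l) (odds (a :: m))].
Proof.
move=> sc; have [n] := ubnP (size l); elim: n l => // n IH [|b [|c l]] //.
  move=> _ _; rewrite inE => /eqP <-; exists [::]; split => //; exact: sorts_to_refl.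
move=> sz ubcl; rewrite inE; case: (eqVneq a b) => [<- _|ab al].
  by exists (c :: l); split=> //; apply: sorts_to_refl.
have [||m [s pe po]] := IH l _ _ al.
- by rewrite ltnS in sz; apply: leq_trans sz; rewrite /= ltnS leqnSn.
- by move: ubcl => /= /and3P[].
(* Reversing the first three letters of [b, c, a, m] gives [a, c, b, m], and each of the three keeps
   its parity. *)
exists [:: c, b & m]; split.
- apply: sorts_to_trans (sorts_to_cons b (sorts_to_cons c s)) _.
  apply: sorts_to_swap3 => //.
  have p : perm_eq [:: b, c & l] [:: b, c, a & m] by rewrite !perm_cons; case: s.
  by rewrite -(perm_uniq p).
- rewrite /= (perm_trans (y := [:: b, a & odds m])) //; first by rewrite perm_cons.
  by rewrite (perm_catCA [:: b] [:: a]).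
- by rewrite /= perm_cons.
Qed.

(** Selection sort again; stripping the common head exchanges the roles of [evens] and [odds]. *)
Lemma perm2_sorts_to l m : shcommP -> uniq l ->
  perm_eq (evens l) (evens m) -> perm_eq (odds l) (odds m) -> sorts_to l m.
Proof.
move=> sc; elim: m l => [|a m IH] l ul el ol.
  have := perm_evens_odds l; rewrite (perm_nilP el) (perm_nilP ol) => /perm_nilP ->.
  exact: sorts_to_refl.
have [|n [s en on]] := sorts_to_head2 sc ul (a := a).
  by rewrite (perm_mem el) mem_head.
apply: (sorts_to_trans s); apply: sorts_to_cons.
have := perm_uniq s.1; rewrite ul => /esym/andP[_ un]; apply: IH => //.
- by apply: perm_trans ol; rewrite perm_sym.
- by rewrite -(perm_cons a); apply: perm_trans el; rewrite perm_sym.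
Qed.

Lemma sorts_to_word (s : 'S_k) :
  sorts_to (enum 'I_k) [seq s r | r <- enum 'I_k] ->
  mono x (word i) = signed (tw && odd (eps_count s i)) (mono x (word_perm s i)).
Proof.
(* The identity permutation has no inversions, so the sign depends on [s] alone. *)
have i0 : invs i (enum 'I_k) = 0.
  by rewrite -[RHS](eps_count1 i) eps_count_invs (eq_map (@perm1 _)) map_id.
by case=> _; rewrite i0 -eps_count_invs addFb -(map_comp i s).
Qed.

End Words.

Lemma perm_enum_map k (s : 'S_k) : perm_eq (enum 'I_k) [seq s r | r <- enum 'I_k].
Proof.
apply: uniq_perm; rewrite ?enum_uniq ?(map_inj_uniq perm_inj) ?enum_uniq // => r.
by rewrite mem_enum; apply/esym/mapP; exists ((s^-1)%g r); rewrite ?mem_enum ?permKV.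
Qed.

Lemma scomm_sRrel k (s : 'S_k) : scommP -> sRrel s.
Proof.
move=> sc i; apply/sorts_to_word/perm_sorts_to; rewrite ?enum_uniq //.
exact: perm_enum_map.
Qed.

Lemma evens_map (T U : Type) (f : T -> U) l : evens (map f l) = map f (evens l)
with odds_map (T U : Type) (f : T -> U) l : odds (map f l) = map f (odds l).
Proof. all: by case: l => //= a l; rewrite ?odds_map ?evens_map. Qed.

(** The start [n] is arbitrary because each induction step shifts it and swaps the two parities. *)
Lemma evens_odds_iota n m :
  evens (iota n m) = [seq r <- iota n m | odd r == odd n] /\
  odds (iota n m) = [seq r <- iota n m | odd r != odd n].
Proof.
elim: m n => //= m IH n; have [-> ->] := IH n.+1; rewrite eqxx /=; split.
- by congr cons; apply: eq_filter => r /=; case: odd; case: odd.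
- by apply: eq_filter => r /=; case: odd; case: odd.
Qed.

Lemma evens_odds_enum k : evens (enum 'I_k) = [seq r : 'I_k <- enum 'I_k | ~~ odd r] /\
  odds (enum 'I_k) = [seq r : 'I_k <- enum 'I_k | odd r].
Proof.
have := evens_odds_iota 0 k; rewrite -val_enum_ord evens_map odds_map !(filter_map val).
move=> [e o]; split; apply: (inj_map val_inj).
  rewrite e; congr (map _ _).
  apply: eq_filter => r /=.
  by case: odd.
rewrite o; congr (map _ _); apply: eq_filter => r /=.
by case: odd.
Qed.

Lemma shcomm_sRrel k (s : 'S_k) : shcommP -> S_infty_star k s -> sRrel s.
Proof.
move=> sc ss i.
(* The positions selected by an [s]-invariant predicate are permuted among themselves; this is
   applied to parity. *)
have stable (P : pred 'I_k) : (forall r, P (s r) = P r) ->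
    perm_eq [seq r <- enum 'I_k | P r] (map s [seq r <- enum 'I_k | P r]).
  move=> e; rewrite -[X in map s X](eq_filter e) -(filter_map s P).
  exact/perm_filter/perm_enum_map.
apply/sorts_to_word/perm2_sorts_to; rewrite ?enum_uniq //.
- by rewrite (evens_map s) (evens_odds_enum k).1 stable // => r; rewrite ss.
- by rewrite (odds_map s) (evens_odds_enum k).2 stable.
Qed.

End Reordering.

(** * Words detecting a permutation *)

Section InversionParity.
Variables (N k : nat) (s : 'S_k).

Definition inverted (r1 r2 : 'I_k) : bool := (r1 < r2)%N && (s r2 < s r1)%N.

(** Count the values below [s r] and the positions below [r]: each [u] contributes equally to both,
    up to its inversions with [r]. *)
Lemma perm_displacement r :
  s r + \sum_u inverted u r = r + \sum_u inverted r u.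
Proof.
have ord_sum (m : 'I_k) : m = \sum_(u < k) (u < m)%N :> nat.
  have e : \sum_(u < k | (u < m)%N) 1 = m.
    by rewrite (big_ord_narrow (ltnW (ltn_ord m))) sum1_card card_ord.
  by rewrite -[LHS]e big_mkcond; apply: eq_bigr => u _; case: ltnP.
rewrite [X in X + _ = _]ord_sum [X in _ = X + _]ord_sum (reindex_inj (@perm_inj _ s)) /=.
rewrite -!big_split /=; apply: eq_bigr => u _; rewrite /inverted.
case: (ltngtP u r) => [||/val_inj ->]; rewrite ?ltnn //= ?addn0 //.
by move=> ur; case: ltngtP => // /val_inj/perm_inj eur; rewrite eur ltnn in ur.
Qed.

Lemma eps_countE (i : 'I_k -> 'I_N) :
  eps_count s i = \sum_r1 \sum_r2 (inverted r1 r2 && (i (s r1) != i (s r2))).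
Proof.
rewrite /eps_count -sum1_card big_mkcond /= pair_bigA /=.
apply: eq_bigr => -[r1 r2] _ /=; rewrite /inverted -andbA.
by rewrite !inE /=; case: (_ && _).
Qed.

Variables a b c : 'I_N.

(** The mark sits at [s r] so that it lands on position [r] of the permuted word, where inversions
    are counted. *)
Definition mark1 (r u : 'I_k) : 'I_N := if u == s r then b else a.
Definition mark2 (r r' u : 'I_k) : 'I_N :=
  if u == s r then b else if u == s r' then c else a.

(** Exactly the inversions involving [r] count, and modulo 2 their number is the displacement of
    [r]. *)
Lemma odd_eps_mark1 r : a != b -> odd (eps_count s (mark1 r)) = odd (s r) (+) odd r.
Proof.
move=> ab.
have -> : eps_count s (mark1 r) = \sum_u inverted u r + \sum_u inverted r u.
  have self : inverted r r = false by rewrite /inverted ltnn.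
  rewrite eps_countE [RHS]addnC (bigD1 r) //= [X in _ = _ + X](bigD1 r) //= self add0n.
  congr (_ + _).
    apply: eq_bigr => u _; rewrite /mark1 eqxx (inj_eq perm_inj).
    by case: (eqVneq u r) => [->|_]; rewrite ?(eq_sym b) ?ab ?andbT // self.
  apply: eq_bigr => u ur; rewrite (bigD1 r) //= big1 ?addn0 => [|v vr].
    by rewrite /mark1 eqxx (inj_eq perm_inj) (negPf ur) ab andbT.
  by rewrite /mark1 !(inj_eq perm_inj) (negPf ur) (negPf vr) eqxx andbF.
have := congr1 odd (perm_displacement r); rewrite !oddD.
by do 4!case: odd.
Qed.

(** An inverted pair with one marked member counts once on each side; the pair [(r, r')] counts
    twice on the left but once for [mark2]. *)
Lemma eps_mark2 r r' : uniq [:: a; b; c] -> inverted r r' ->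
  eps_count s (mark1 r) + eps_count s (mark1 r') = (eps_count s (mark2 r r')).+1.
Proof.
rewrite /= !inE negb_or !andbT => /andP[/andP[ab ac] bc] inv.
have rr' : r != r' by apply: contraTneq inv => ->; rewrite /inverted ltnn.
have one : \sum_r1 \sum_r2 ((r1 == r) && (r2 == r') : nat) = 1.
  rewrite (bigD1 r) //= [X in _ + X]big1 => [|u ur]; last first.
    by rewrite big1 // => v _; rewrite (negPf ur).
  rewrite (bigD1 r') //= big1 => [|u ur']; last by rewrite (negPf ur') andbF.
  by rewrite !eqxx.
rewrite -addn1 -[in RHS]one !eps_countE -!big_split /=; apply: eq_bigr => r1 _.
rewrite -!big_split /=; apply: eq_bigr => r2 _.
have [ba [ca cb]] : b != a /\ c != a /\ c != b by rewrite !(eq_sym _ a) (eq_sym c).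
rewrite /mark1 /mark2 !(inj_eq perm_inj).
have [->|r1r] := eqVneq r1 r; have [->|r2r'] := eqVneq r2 r'; rewrite ?inv ?eqxx.
- by rewrite (eq_sym r') (negPf rr') ba ab bc.
- by case: (eqVneq r2 r) => [->|]; rewrite ?(negPf rr') ?eqxx ?ba ?andbF ?addn0 //=.
- case: (eqVneq r1 r') => [->|]; rewrite ?(eq_sym r') ?(negPf rr') ?eqxx ?ab ?ac ?andbF ?addn0 //=.
- have [e2|r2r] := eqVneq r2 r; have [e1|r1r'] := eqVneq r1 r'; 
   rewrite ?e1 ?e2 ?eqxx ?ab ?ac ?bc ?ba ?ca ?cb ?andbF ?addn0 ?andbT //=.
  (* The reversed pair also carries both marks, but it is not an inversion since [r < r']. *)
  have -> // : inverted r' r = false.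
  by move: inv; rewrite /inverted => /andP[/ltnW]; rewrite leqNgt => /negPf ->.
Qed.

End InversionParity.

(** Restricting to two letters makes this applicable to points with only two nonzero coordinates. *)
Lemma even_eps_S_infty_star N k (s : 'S_k) (a b : 'I_N) : a != b ->
  (forall i, (forall u, i u \in [:: a; b]) -> ~~ odd (eps_count s i)) ->
  S_infty_star k s.
Proof.
move=> ab even_eps r.
have := even_eps (mark1 s a b r); rewrite odd_eps_mark1 //.
have h u : mark1 s a b r u \in [:: a; b].
  by rewrite /mark1 !inE; case: (u == s r); rewrite eqxx ?orbT.
by move=> /(_ h); do 2!case: odd.
Qed.

Lemma even_eps_perm1 N k (s : 'S_k) (a b c : 'I_N) : uniq [:: a; b; c] ->
  (forall i, (forall u, i u \in [:: a; b; c]) -> ~~ odd (eps_count s i)) -> s = 1%g.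
Proof.
move=> uabc even_eps.
have even1 r : ~~ odd (eps_count s (mark1 s a b r)).
  by apply: even_eps => u; rewrite /mark1 !inE; case: (u == s r); rewrite eqxx ?orbT.
have even2 r r' : ~~ odd (eps_count s (mark2 s a b c r r')).
  apply: even_eps => u; rewrite /mark2 !inE.
  by case: (u == s r); last case: (u == s r'); rewrite eqxx ?orbT.
have noinv r r' : inverted s r r' = false.
  apply/negP => /(eps_mark2 uabc)/(congr1 odd); rewrite oddD /=.
  by rewrite !(negPf (even1 _)) (negPf (even2 _ _)).
apply/permP => r; rewrite perm1; apply: val_inj => /=.
(* Without inversions the displacement formula reads [s r = r]. *)
have := perm_displacement s r.
by rewrite !big1 ?addn0 // => u _; rewrite noinv.
Qed.

Section Obstruction.
Variables (N : nat) (A : CStarAlgebra) (x : 'I_N -> A) (tw : bool) (L : seq 'I_N).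
Hypothesis one_neq0 : ca_one <> ca_zero :> A.
Hypothesis x_linv : forall j, j \in L -> exists y, ca_mul y (x j) = ca_one.

Lemma mono_linv w : {subset w <= L} -> exists y, ca_mul y (mono x w) = ca_one.
Proof.
elim: w => [|j w IH] wL; first by exists ca_one; apply: ca_mul1l.
have [y yj] := x_linv (wL j (mem_head j w)).
have [|z zw] := IH; first by move=> u uw; apply: wL; rewrite inE uw orbT.
by exists (ca_mul z y); rewrite mono_cons -ca_mulA [ca_mul y _]ca_mulA yj ca_mul1l.
Qed.

(** Both twists express the same word through the same nonzero monomial, so their signs agree; only
    one of the two sees the parity of [eps_count]. *)
Lemma even_eps_opposite_twist k (s : 'S_k) : scommP x (~~ tw) -> sRrel x tw s ->
  forall i, (forall u, i u \in L) -> ~~ odd (eps_count s i).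
Proof.
move=> sc rs i iL; have := scomm_sRrel s sc i; rewrite (rs i) => /signed_inj_sign e.
suff /e : mono x (word_perm s i) <> ca_zero by case: (tw); case: odd.
have [|y yw] := @mono_linv (word_perm s i).
  by move=> j /mapP[r _ ->].
by move=> m0; apply: one_neq0; rewrite -yw m0 ca_mulr0.
Qed.

End Obstruction.

(** * Commutation, half-commutation and polygonal relations *)

Lemma enum_ord2 : enum 'I_2 = [:: ord0; ord_max].
Proof. by apply: (inj_map val_inj); rewrite val_enum_ord. Qed.

Lemma enum_ord3 : enum 'I_3 = [:: ord0; lift ord0 ord0; ord_max].
Proof. by apply: (inj_map val_inj); rewrite val_enum_ord. Qed.

Lemma word2E N (i : 'I_2 -> 'I_N) : word i = [:: i ord0; i ord_max].
Proof. by rewrite /word enum_ord2. Qed.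

Lemma word3E N (i : 'I_3 -> 'I_N) :
  word i = [:: i ord0; i (lift ord0 ord0); i ord_max].
Proof. by rewrite /word enum_ord3. Qed.

Lemma distinct3 (T : eqType) (i j k : T) :
  ((i != j) (+) (j != k) (+) (i != k)) = [&& i != j, j != k & i != k].
Proof.
case: (eqVneq i j) => [->|ij]; first by case: eqVneq.
by case: (eqVneq j k) => [<-|jk]; rewrite ?(negPf ij) //=; case: eqVneq.
Qed.

Section Relations.
Variables (N : nat) (A : CStarAlgebra) (x : 'I_N -> A).

Lemma scommP_true : scommP x true <-> acommP x.
Proof.
split=> h i j; first by move=> ij; rewrite (h i j) ij.
by case: (eqVneq i j) => [->//|ij]; apply: h.
Qed.

Lemma shcommP_true : shcommP x true <-> bhcommP x.
Proof.
by split=> h i j k; have := h i j k; rewrite /signed /= distinct3; case: [&& _, _ & _].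
Qed.

Lemma polyP1 : polyP x 1 <-> forall i j, i != j -> ca_mul (x i) (x j) = ca_zero.
Proof.
split=> [h i j ij|h i inj_i].
  have := h (tnth [tuple i; j]); rewrite word2E /mono /= ca_mul1r; apply=> u v e.
  apply/eqP; rewrite -[_ == _](nth_uniq i (s := [:: i; j])) ?ltn_ord //.
    by rewrite -!tnth_nth /= e.
  by rewrite /= inE ij.
by rewrite word2E /mono /= ca_mul1r; apply: h; rewrite (inj_eq inj_i).
Qed.

Lemma polyP2 : polyP x 2 <->
  forall i j k, [&& i != j, j != k & i != k] -> mono x [:: i; j; k] = ca_zero.
Proof.
split=> [h i j k /and3P[ij jk ik]|h i inj_i]; last first.
  by rewrite word3E; apply: h; rewrite !(inj_eq inj_i).
have := h (tnth [tuple i; j; k]); rewrite word3E; apply=> u v e.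
apply/eqP; rewrite -[_ == _](nth_uniq i (s := [:: i; j; k])) ?ltn_ord //.
  by rewrite -!tnth_nth /= e.
by rewrite /= !inE negb_or ij ik jk.
Qed.

Lemma sRrel_scommP tw : (forall k (s : 'S_k), sRrel x tw s) -> scommP x tw.
Proof.
move=> h i j; have := h 2 (tperm ord0 ord_max) (tnth [tuple i; j]).
rewrite eps_count_invs /word_perm enum_ord2 word2E /= tpermL tpermR /mono /=.
by rewrite !ca_mul1r /twinv /= !(tnth_nth i) /= !addn0 oddb (eq_sym j).
Qed.

(** Exchanging the outer two of three positions preserves parity, and its relation is
    half-commutation. *)
Lemma sRrel_shcommP tw :
  (forall k (s : 'S_k), S_infty_star k s -> sRrel x tw s) -> shcommP x tw.
Proof.
move=> h i j k; set s : 'S_3 := tperm ord0 ord_max.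
have s1 : s (lift ord0 ord0) = lift ord0 ord0 by rewrite tpermD.
have ss : S_infty_star 3 s by move=> r; rewrite /s; case: tpermP => [->|->|].
have := h 3 s ss (tnth [tuple i; j; k]).
rewrite eps_count_invs /word_perm enum_ord3 word3E /= s1 tpermL tpermR.
rewrite !(tnth_nth i) /= /twinv /= !(tnth_nth i) /= !addn0.
rewrite !oddD !oddb (eq_sym k j) (eq_sym k i) (eq_sym j i).
by case: (i != j); case: (j != k); case: (i != k).
Qed.

Lemma scommP_shcommP tw : scommP x tw -> shcommP x tw.
Proof.
by move=> sc; apply: sRrel_shcommP => k s _; apply: scomm_sRrel.
Qed.

(** The two forms of half-commutation differ only on distinct triples, where polygonality makes both
    sides zero. *)
Lemma shcommP_polyP tw : polyP x 2 -> shcommP x tw -> shcommP x (~~ tw).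
Proof.
move/polyP2 => p h i j k; move: (h i j k); rewrite distinct3.
have [/and3P[ij jk ik] _|_] := boolP [&& i != j, j != k & i != k]; last by rewrite !andbF.
rewrite !p ?ij ?jk ?ik //; last by rewrite (eq_sym k j) (eq_sym k i) (eq_sym j i) jk ik ij.
by rewrite !signed0.
Qed.

Lemma shcommP_both_polyP : shcommP x false -> shcommP x true -> polyP x 2.
Proof.
move=> h bh; apply/polyP2 => i j k /and3P[ij jk ik]; apply: ca_eqN0.
by have := bh i j k; rewrite ij jk ik (h k j i).
Qed.

Lemma scommP_polyP tw : polyP x 1 -> scommP x tw -> scommP x (~~ tw).
Proof.
move/polyP1 => p h i j; case: (eqVneq i j) => [->|ij]; first by rewrite andbF.
by rewrite (p i j ij) (p j i) 1?eq_sym // !signed0.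
Qed.

Lemma scommP_both_polyP : scommP x false -> scommP x true -> polyP x 1.
Proof.
move=> c ac; apply/polyP1 => i j ij; apply: ca_eqN0.
by have := ac i j; rewrite ij (c j i).
Qed.

End Relations.


(** * The C*-algebra of complex 2 x 2 matrices *)

Section MatrixAlgebra.
Local Open Scope R_scope.

Definition Cvec2 : Type := (Cplx * Cplx)%type.
(** Matrices are pairs of rows built from pairs of reals, so identities split into ring
    equations. *)
Definition Mat2 : Type := (Cvec2 * Cvec2)%type.
Implicit Types (a b : Mat2) (v w : Cvec2) (z : Cplx).

Definition vadd v w : Cvec2 := (Cadd v.1 w.1, Cadd v.2 w.2).
Definition vscal z v : Cvec2 := (Cmul z v.1, Cmul z v.2).
(** The real part of the Hermitian product; it has the same norm, and [mstar] is still the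
    adjoint. *)
Definition vdot v w : R := v.1.1 * w.1.1 + v.1.2 * w.1.2 + v.2.1 * w.2.1 + v.2.2 * w.2.2.
Definition vlen v : R := sqrt (vdot v v).

Definition madd a b : Mat2 := (vadd a.1 b.1, vadd a.2 b.2).
Definition mscal z a : Mat2 := (vscal z a.1, vscal z a.2).
Definition mapp a v : Cvec2 :=
  (Cadd (Cmul a.1.1 v.1) (Cmul a.1.2 v.2), Cadd (Cmul a.2.1 v.1) (Cmul a.2.2 v.2)).
Definition mstar a : Mat2 :=
  ((Cconj a.1.1, Cconj a.2.1), (Cconj a.1.2, Cconj a.2.2)).
Definition mmul a b : Mat2 :=
  let c1 := mapp a (b.1.1, b.2.1) in let c2 := mapp a (b.1.2, b.2.2) in
  ((c1.1, c2.1), (c1.2, c2.2)).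
Definition mdiag z : Mat2 := ((z, (0, 0)), ((0, 0), z)).
Definition mopp a : Mat2 := mscal (-1, 0) a.

Ltac mring := intros;
  repeat match goal with
    | a : Mat2 |- _ => destruct a as [[[? ?] [? ?]] [[? ?] [? ?]]]
    | v : Cvec2 |- _ => destruct v as [[? ?] [? ?]]
    | z : Cplx |- _ => destruct z as [? ?] end;
  unfold mmul, madd, mscal, mapp, mstar, mopp, mdiag, vadd, vscal, vdot, Cadd, Cmul, Cconj, Cone;
  simpl;
  repeat match goal with |- (_, _) = (_, _) => apply f_equal2 end; ring.

Lemma vdot_mstar a v w : vdot (mapp a v) w = vdot v (mapp (mstar a) w).
Proof. mring. Qed.

Lemma mapp_mmul a b v : mapp (mmul a b) v = mapp a (mapp b v).
Proof. mring. Qed.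

Lemma mapp_madd a b v : mapp (madd a b) v = vadd (mapp a v) (mapp b v).
Proof. mring. Qed.

Lemma mapp_mscal z a v : mapp (mscal z a) v = vscal z (mapp a v).
Proof. mring. Qed.

Lemma mscalA z z' a : mscal z (mscal z' a) = mscal (Cmul z z') a.
Proof. mring. Qed.

Lemma mscal1 a : mscal Cone a = a.
Proof. mring. Qed.

Lemma vdot_vadd v w :
  vdot (vadd v w) (vadd v w) = vdot v v + 2 * vdot v w + vdot w w.
Proof. mring. Qed.

Lemma vdot_ge0 v : 0 <= vdot v v.
Proof. by rewrite /vdot; nra. Qed.

Lemma vlen_ge0 v : 0 <= vlen v.
Proof. exact: sqrt_pos. Qed.

Lemma vlen_sqr v : vlen v * vlen v = vdot v v.
Proof. exact/sqrt_sqrt/vdot_ge0. Qed.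

Lemma sqr_le_inv (r t : R) : 0 <= t -> r * r <= t * t -> r <= t.
Proof. by move=> t0 rt; apply: Rnot_lt_le => tr; nra. Qed.

(** Lagrange's identity: the gap is the sum of the squares of the six minors. *)
Lemma vdot_sqr_le v w : vdot v w * vdot v w <= vdot v v * vdot w w.
Proof.
case: v => [[p q] [r s]]; case: w => [[p' q'] [r' s']]; rewrite /vdot /=.
have := (Rle_0_sqr (p * q' - q * p'), Rle_0_sqr (p * r' - r * p'),
         Rle_0_sqr (p * s' - s * p'), Rle_0_sqr (q * r' - r * q'),
         Rle_0_sqr (q * s' - s * q'), Rle_0_sqr (r * s' - s * r')).
rewrite /Rsqr => -[[[[[h1 h2] h3] h4] h5] h6]; nra.
Qed.

Lemma vdot_le v w : vdot v w <= vlen v * vlen w.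
Proof.
apply: sqr_le_inv; first by apply: Rmult_le_pos; apply: vlen_ge0.
have -> : vlen v * vlen w * (vlen v * vlen w) = vdot v v * vdot w w.
  by rewrite -!vlen_sqr; ring.
exact: vdot_sqr_le.
Qed.

Lemma vlen_vadd v w : vlen (vadd v w) <= vlen v + vlen w.
Proof.
have v0 := vlen_ge0 v; have w0 := vlen_ge0 w.
apply: sqr_le_inv; first lra.
by rewrite vlen_sqr vdot_vadd -!vlen_sqr; have := vdot_le v w; lra.
Qed.

Lemma vlen_vscal z v : vlen (vscal z v) = Cmod z * vlen v.
Proof.
rewrite /vlen /Cmod -sqrt_mult_alt; last nra.
by congr sqrt; mring.
Qed.

Definition opbound a (C : R) : Prop := 0 <= C /\ forall v, vlen (mapp a v) <= C * vlen v.

(** The booleans select row, column and imaginary part, so entries are handled by case analysis. *)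
Definition entry a (i j part : bool) : R :=
  let r := if i then a.2 else a.1 in
  let z := if j then r.2 else r.1 in if part then z.2 else z.1.

Definition mat_of (f : bool -> bool -> bool -> R) : Mat2 :=
  let z i j := (f i j false, f i j true) in
  ((z false false, z false true), (z true false, z true true)).

Lemma entry_mat_of f i j p : entry (mat_of f) i j p = f i j p.
Proof. by case: i; case: j; case: p. Qed.

(** A row has squared length at most [4 d^2]. By Cauchy-Schwarz, the real and imaginary parts of its
    product with a unit vector together give [8 d^2], and the two rows [16 d^2]. *)
Lemma opbound_entries a (d : R) :
  0 <= d -> (forall i j p, Rabs (entry a i j p) <= d) -> opbound a (4 * d).
Proof.
move=> d0 ed; split=> [|v]; first lra.
have ed2 i j p : entry a i j p * entry a i j p <= d * d.
  by rewrite -[X in X <= _]Rabs_pos_eq ?Rabs_mult; last nra;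
     have := ed i j p; have := Rabs_pos (entry a i j p); nra.
apply: sqr_le_inv; first by have := vlen_ge0 v; nra.
have row (r : Cvec2) : vdot r r <= 4 * (d * d) ->
    let t := Cadd (Cmul r.1 v.1) (Cmul r.2 v.2) in
    t.1 * t.1 + t.2 * t.2 <= 8 * (d * d) * vdot v v.
  move=> rd /=.
  have e1 := vdot_sqr_le (Cconj r.1, Cconj r.2) v.
  have e2 := vdot_sqr_le ((r.1.2, r.1.1), (r.2.2, r.2.1)) v.
  have n1 : vdot (Cconj r.1, Cconj r.2) (Cconj r.1, Cconj r.2) = vdot r r by mring.
  have n2 : vdot ((r.1.2, r.1.1), (r.2.2, r.2.1)) ((r.1.2, r.1.1), (r.2.2, r.2.1)) = vdot r r.
    by mring.
  have := Rmult_le_compat_r _ _ _ (vdot_ge0 v) rd.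
  move: e1 e2; rewrite n1 n2; move: (vdot v v) (vdot r r) => V D.
  by rewrite /vdot /=; lra.
rewrite vlen_sqr.
have -> : 4 * d * vlen v * (4 * d * vlen v) = 16 * (d * d) * vdot v v.
  by rewrite -vlen_sqr; ring.
have r1 : vdot a.1 a.1 <= 4 * (d * d).
  have := (ed2 false false false, ed2 false false true, ed2 false true false, ed2 false true true).
  by rewrite /entry /vdot => -[[[h1 h2] h3] h4]; lra.
have r2 : vdot a.2 a.2 <= 4 * (d * d).
  have := (ed2 true false false, ed2 true false true, ed2 true true false, ed2 true true true).
  by rewrite /entry /vdot => -[[[h1 h2] h3] h4]; lra.
by have := (row _ r1, row _ r2) => -[] /= h1 h2; rewrite {1}/vdot /=; lra.
Qed.

Lemma opbound_ex a : exists C, opbound a C.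
Proof.
pose f := entry a.
pose d := Rabs (f false false false) + Rabs (f false false true)
  + Rabs (f false true false) + Rabs (f false true true)
  + Rabs (f true false false) + Rabs (f true false true)
  + Rabs (f true true false) + Rabs (f true true true).
have pos i j p : 0 <= Rabs (f i j p) by apply: Rabs_pos.
have := (pos false false false, pos false false true, pos false true false,
  pos false true true, pos true false false, pos true false true, pos true true false,
  pos true true true) => -[[[[[[[h1 h2] h3] h4] h5] h6] h7] h8].
exists (4 * d); apply: opbound_entries; first by rewrite /d; lra.
by rewrite -/f /d; case; case; case; lra.
Qed.

Lemma opbound_bounded a : bound (fun y => opbound a (- y)).
Proof. by exists 0 => y [y0 _]; lra. Qed.

Lemma opbound_inhabited a : exists y, opbound a (- y).
Proof. by have [C bC] := opbound_ex a; exists (- C); rewrite Ropp_involutive. Qed.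

(* The least bound; [completeness] provides suprema only, hence the signs. *)
Definition opnorm a : R := - sval (completeness _ (opbound_bounded a) (opbound_inhabited a)).

Lemma opnorm_le a C : opbound a C -> opnorm a <= C.
Proof.
rewrite /opnorm => bC; case: completeness => m /= [ub _].
by have := ub (- C); rewrite Ropp_involutive => /(_ bC); lra.
Qed.

(** For [vlen v] nonzero the ratio of lengths lies below every bound, hence below their infimum; for
    [vlen v = 0] any bound forces zero. *)
Lemma opbound_opnorm a : opbound a (opnorm a).
Proof.
rewrite /opnorm; case: completeness => m /= [ub least]; split.
  by have : m <= 0 by [apply: least => y [y0 _]; lra]; lra.
move=> v; have v0 := vlen_ge0 v.
have [v_eq0|v_neq0] := Req_dec (vlen v) 0.
  have [C [_ /(_ v)]] := opbound_ex a; rewrite v_eq0; lra.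
suff h : m <= - (vlen (mapp a v) / vlen v).
  have -> : vlen (mapp a v) = vlen (mapp a v) / vlen v * vlen v by field.
  by apply: Rmult_le_compat_r => //; lra.
apply: least => y [_ /(_ v) bv]; suff : vlen (mapp a v) / vlen v <= - y by lra.
apply: (Rmult_le_reg_r (vlen v)); first lra.
by rewrite /Rdiv Rmult_assoc Rinv_l // Rmult_1_r.
Qed.

Lemma opnorm_ge0 a : 0 <= opnorm a.
Proof. by case: (opbound_opnorm a). Qed.

Lemma vlen_mapp a v : vlen (mapp a v) <= opnorm a * vlen v.
Proof. by case: (opbound_opnorm a). Qed.

(** Entries are coordinates of the columns, which are images of unit basis vectors. *)
Lemma entry_le_opnorm a i j p : Rabs (entry a i j p) <= opnorm a.
Proof.
have h v : vdot v v = 1 -> vdot (mapp a v) (mapp a v) <= opnorm a * opnorm a.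
  move=> v1; have lv : vlen v = 1 by rewrite /vlen v1 sqrt_1.
  have := vlen_mapp a v; have := vlen_ge0 (mapp a v); have := opnorm_ge0 a.
  by rewrite -vlen_sqr lv; nra.
apply: sqr_le_inv; first exact: opnorm_ge0.
rewrite -Rabs_mult Rabs_pos_eq; last nra.
have e1 := h ((1, 0), (0, 0)); have e2 := h ((0, 0), (1, 0)).
rewrite /vdot /= in e1 e2.
have {}e1 := e1 ltac:(ring); have {}e2 := e2 ltac:(ring).
by case: i; case: j; case: p; rewrite /entry /=; nra.
Qed.

Lemma opnormD a b : opnorm (madd a b) <= opnorm a + opnorm b.
Proof.
apply: opnorm_le; split; first by have := (opnorm_ge0 a, opnorm_ge0 b) => -[]; lra.
move=> v; rewrite mapp_madd; apply: Rle_trans (vlen_vadd _ _) _.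
by have := (vlen_mapp a v, vlen_mapp b v) => -[]; lra.
Qed.

Lemma opnormM a b : opnorm (mmul a b) <= opnorm a * opnorm b.
Proof.
have a0 := opnorm_ge0 a; have b0 := opnorm_ge0 b.
apply: opnorm_le; split; first nra.
move=> v; rewrite mapp_mmul; apply: Rle_trans (vlen_mapp _ _) _.
by rewrite Rmult_assoc; apply: Rmult_le_compat_l => //; apply: vlen_mapp.
Qed.

Lemma opnormZ_le z a : opnorm (mscal z a) <= Cmod z * opnorm a.
Proof.
have z0 : 0 <= Cmod z by apply: sqrt_pos.
apply: opnorm_le; split; first by have := opnorm_ge0 a; nra.
move=> v; rewrite mapp_mscal vlen_vscal Rmult_assoc.
by apply: Rmult_le_compat_l => //; apply: vlen_mapp.
Qed.

Lemma opnormZ z a : opnorm (mscal z a) = Cmod z * opnorm a.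
Proof.
apply: Rle_antisym; first exact: opnormZ_le.
have z0 : 0 <= Cmod z by apply: sqrt_pos.
have [->|zn0] := Req_dec (Cmod z) 0; first by rewrite Rmult_0_l; apply: opnorm_ge0.
have zz : z.1 * z.1 + z.2 * z.2 = Cmod z * Cmod z by rewrite sqrt_sqrt //; nra.
have zz0 : z.1 * z.1 + z.2 * z.2 <> 0 by rewrite zz; nra.
(* The inverse of [z]: the inequality for [z'] and [mscal z a] gives the converse estimate. *)
pose z' : Cplx := (z.1 / (z.1 * z.1 + z.2 * z.2), - z.2 / (z.1 * z.1 + z.2 * z.2)).
have z'z : Cmul z' z = Cone.
  by rewrite /z' /Cmul /Cone /=; apply: f_equal2; field.
have mod_z' : Cmod z' = / Cmod z.
  rewrite {1}/Cmod /=; apply: (Rmult_eq_reg_r (Cmod z)) => //; rewrite Rinv_l //.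
  rewrite -sqrt_mult_alt; last nra.
  rewrite -[RHS]sqrt_1; congr sqrt; field; nra.
have := opnormZ_le z' (mscal z a); rewrite mscalA z'z mscal1 mod_z' => h.
have := Rmult_le_compat_l _ _ _ z0 h.
by rewrite -Rmult_assoc Rinv_r // Rmult_1_l.
Qed.

(** The squared length of [w] is the product of [a w] with [v], at most
    [opnorm a * vlen w * vlen v]; then divide by [vlen w]. *)
Lemma opnorm_mstar_le a : opnorm (mstar a) <= opnorm a.
Proof.
apply: opnorm_le; split=> [|v]; first exact: opnorm_ge0.
set w := mapp (mstar a) v; have w0 := vlen_ge0 w; have v0 := vlen_ge0 v.
have a0 := opnorm_ge0 a.
have : vlen w * vlen w <= opnorm a * vlen w * vlen v.
  rewrite vlen_sqr {2}/w -vdot_mstar; apply: Rle_trans (vdot_le _ _) _.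
  by apply: Rmult_le_compat_r => //; apply: vlen_mapp.
by have [w_eq0|w_neq0] := Req_dec (vlen w) 0; nra.
Qed.

(** For the lower bound, the squared length of [a v] is the product of [v] with [c v], hence at most
    [opnorm c] times that of [v]. *)
Lemma opnorm_cstar a : opnorm (mmul (mstar a) a) = opnorm a * opnorm a.
Proof.
have a0 := opnorm_ge0 a; set c := mmul (mstar a) a; have c0 := opnorm_ge0 c.
apply: Rle_antisym.
  apply: Rle_trans (opnormM _ _) _; apply: Rmult_le_compat_r => //.
  exact: opnorm_mstar_le.
have sc := sqrt_pos (opnorm c); have sc2 := sqrt_sqrt _ c0.
suff : opnorm a <= sqrt (opnorm c) by nra.
apply: opnorm_le; split=> // v; have v0 := vlen_ge0 v.
apply: sqr_le_inv; first nra.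
rewrite vlen_sqr vdot_mstar -mapp_mmul -/c.
have := vdot_le v (mapp c v); have := vlen_mapp c v.
have -> : sqrt (opnorm c) * vlen v * (sqrt (opnorm c) * vlen v) = opnorm c * (vlen v * vlen v).
  by rewrite -{3}sc2; ring.
nra.
Qed.

Lemma entryD a b i j p : entry (madd a b) i j p = entry a i j p + entry b i j p.
Proof. by case: i; case: j; case: p. Qed.

Lemma entryN a i j p : entry (mopp a) i j p = - entry a i j p.
Proof. by case: i; case: j; case: p; rewrite /entry /=; ring. Qed.

Lemma opnorm_eq0 a : opnorm a = 0 -> a = mdiag (0, 0).
Proof.
move=> a0; have e i j p : entry a i j p = 0.
  have := entry_le_opnorm a i j p; rewrite a0 => h.
  by apply: NNPP => /Rabs_no_R0; have := Rabs_pos (entry a i j p); lra.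
case: a {a0} e => [[[p q] [r s]] [[p' q'] [r' s']]] e.
have := (e false false false, e false false true, e false true false, e false true true,
  e true false false, e true false true, e true true false, e true true true).
by rewrite /entry /= => -[[[[[[[-> ->] ->] ->] ->] ->] ->] ->].
Qed.

(** Merges two thresholds; three nested uses cover the eight entries. *)
Lemma eventually_bool (P : bool -> nat -> Prop) :
  (forall c : bool, exists n0, forall n, (n0 <= n)%N -> P c n) ->
  exists n0, forall n, (n0 <= n)%N -> forall c : bool, P c n.
Proof.
move=> ev; have [n0 h0] := ev false; have [n1 h1] := ev true.
exists (maxn n0 n1) => n; rewrite geq_max => /andP[n0n n1n] [|].
  exact: h1.
exact: h0.
Qed.

Lemma opnorm_complete (u : nat -> Mat2) :
  (forall eps, 0 < eps -> exists n0, forall m n, (n0 <= m)%N -> (n0 <= n)%N ->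
     opnorm (madd (u m) (mopp (u n))) < eps) ->
  exists l, forall eps, 0 < eps -> exists n0, forall n, (n0 <= n)%N ->
     opnorm (madd (u n) (mopp l)) < eps.
Proof.
move=> cu; have cauchy i j p : Cauchy_crit (fun n => entry (u n) i j p).
  move=> eps /cu[n0 h]; exists n0 => n m /leP n0n /leP n0m.
  apply: Rle_lt_trans (h n m n0n n0m); rewrite /Rdist /Rminus -entryN -entryD.
  exact: entry_le_opnorm.
pose l := mat_of (fun i j p => sval (R_complete _ (cauchy i j p))).
exists l => eps eps0.
(* [opbound_entries] costs a factor 4, so [eps / 8] leaves [eps / 2], strictly below [eps]. *)
have ev i j p : exists n0, forall n, (n0 <= n)%N ->
    Rabs (entry (madd (u n) (mopp l)) i j p) <= eps / 8.
  have := svalP (R_complete _ (cauchy i j p)) (eps / 8); case=> [|n0 h]; first lra.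
  exists n0 => n /leP n0n; rewrite entryD entryN entry_mat_of.
  exact/Rlt_le/h.
have [n0 h] := eventually_bool (fun i => eventually_bool (fun j => eventually_bool (ev i j))).
exists n0 => n n0n; apply: (Rle_lt_trans _ (4 * (eps / 8))); last lra.
by apply/opnorm_le/opbound_entries; [lra|exact: h].
Qed.

(** Transparent, so that products in the models below compute. *)
Definition Mat2Cstar : CStarAlgebra.
Proof.
refine (@Build_CStarAlgebra Mat2 (mdiag (0, 0)) (mdiag Cone) madd mopp mmul mscal mstar
  opnorm _ _ _ _ _ _ _ _ _ _ _ _ _ _ _ _ _ _ _ _ opnormD opnormZ opnormM opnorm_cstar
  opnorm_complete); last exact: opnorm_eq0.
all: abstract mring.
Defined.

End MatrixAlgebra.

(** * Test points with matrix coordinates *)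

Lemma sumsq_count N (A : CStarAlgebra) (x : 'I_N -> A) (P : pred 'I_N) (r : R) :
  (forall j, ca_mul (x j) (x j) = if P j then ca_scal (r, R0) ca_one else ca_zero) ->
  sumsq x = ca_scal (Rmult (INR (count P (enum 'I_N))) r, R0) ca_one.
Proof.
rewrite /sumsq => xx; elim: (enum 'I_N) => [|j l IH] /=.
  apply: (@ca_addI _ (ca_scal (r, R0) ca_one)).
  by rewrite ca_addr0 -ca_scalDl; congr ca_scal; rewrite /Cadd /=; congr pair; ring.
rewrite IH xx plus_INR; case: (P j); last by rewrite ca_add0 Rplus_0_l.
by rewrite -ca_scalDl; congr ca_scal; rewrite /Cadd /=; congr pair; ring.
Qed.

Section Models.
Local Open Scope R_scope.

(* The Pauli matrices when [tw] holds, three copies of the unit otherwise. *)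
Definition pauli (tw : bool) (n : nat) : Mat2Cstar :=
  if tw then
    match n with
    | 0%N => (((0, 0), (1, 0)), ((1, 0), (0, 0)))
    | 1%N => (((0, 0), (0, -1)), ((0, 1), (0, 0)))
    | _ => (((1, 0), (0, 0)), ((0, 0), (-1, 0)))
    end
  else mdiag Cone.

Ltac mcompute :=
  rewrite /pauli /= /mmul /mapp /mstar /mdiag /mopp /mscal /vscal /Cconj /Cadd /Cmul /Cone /=;
  repeat match goal with |- (_, _) = (_, _) => apply f_equal2 end; ring.

Lemma pauli_star tw n : ca_star (pauli tw n) = pauli tw n.
Proof. by case: tw; case: n => [|[|n]]; mcompute. Qed.

Lemma pauli_sqr tw n : ca_mul (pauli tw n) (pauli tw n) = ca_one.
Proof. by case: tw; case: n => [|[|n]]; mcompute. Qed.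

(** The bounds matter: all indices from 2 on give the same matrix. *)
Lemma pauli_scomm tw m n : (m < 3)%N -> (n < 3)%N ->
  ca_mul (pauli tw m) (pauli tw n) =
  signed (tw && (m != n)) (ca_mul (pauli tw n) (pauli tw m)).
Proof.
by case: tw => //; case: m => [|[|[|m]]] //; case: n => [|[|[|n]]] // _ _;
   rewrite /signed /=; mcompute.
Qed.

Variables (N d : nat) (tw : bool).
Hypotheses (d_gt0 : (0 < d)%N) (d_le3 : (d <= 3)%N) (d_leN : (d <= N)%N).

(** The scalar normalises the sum of squares. Two nonzero coordinates give a polygonal point, three
    a point that detects every nontrivial permutation. *)
Definition point (j : 'I_N) : Mat2Cstar :=
  if (j < d)%N then ca_scal (/ sqrt (INR d), 0) (pauli tw j) else ca_zero.

Let sqrt_d_gt0 : 0 < sqrt (INR d).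
Proof. by apply: sqrt_lt_R0; apply: lt_0_INR; apply/ltP. Qed.

Lemma point_scomm : scommP point tw.
Proof.
move=> i j; rewrite /point.
case: ifP => di; last by rewrite ca_mul0r ca_mulr0 signed0.
case: ifP => dj; last by rewrite ca_mul0r ca_mulr0 signed0.
rewrite -val_eqE !ca_scal_mull !ca_scal_mulr (@pauli_scomm tw i j) ?signed_scal //.
  exact: leq_trans di d_le3.
exact: leq_trans dj d_le3.
Qed.

Lemma point_sphere : sphereP point.
Proof.
split=> [j|].
  rewrite /point; case: ifP => _.
    rewrite ca_starZ pauli_star /Cconj /= Ropp_0 //.
  by mcompute.
rewrite (@sumsq_count _ _ _ (fun j : 'I_N => (j < d)%N) (/ INR d)) => [|j]; last first.
  rewrite /point; case: ifP => _; last by rewrite ca_mul0r.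
  rewrite ca_scal_mull ca_scal_mulr pauli_sqr ca_scalA; congr ca_scal.
  rewrite /Cmul; cbn [fst snd]; apply: f_equal2; last ring.
  by rewrite Rmult_0_l Rminus_0_r -Rinv_mult sqrt_sqrt //; apply: pos_INR.
rewrite -sum1_count big_enum_cond (big_ord_narrow d_leN) sum1_card card_ord.
rewrite -[RHS]ca_scal1; congr ca_scal; rewrite /Cone; apply: f_equal2 => //.
by apply: Rinv_r; apply: not_0_INR; apply/eqP/lt0n_neq0.
Qed.

Lemma point_linv (j : 'I_N) : (j < d)%N -> exists y, ca_mul y (point j) = ca_one.
Proof.
move=> jd; exists (ca_scal (sqrt (INR d), 0) (pauli tw j)).
rewrite /point jd ca_scal_mull ca_scal_mulr pauli_sqr ca_scalA.
rewrite -[RHS]ca_scal1; congr ca_scal; rewrite /Cmul /Cone /=.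
by apply: f_equal2; field; lra.
Qed.

Lemma point_polyP : (d <= 2)%N -> polyP point 2.
Proof.
move=> d2; apply/polyP2 => i j k /and3P[ij jk ik].
have point0 (u : 'I_N) : (u < d)%N = false -> point u = ca_zero.
  by rewrite /point => ->.
rewrite !mono_cons.
case di: (i < d)%N; last by rewrite point0 // ca_mul0r.
case dj: (j < d)%N; last by rewrite (point0 j) // ca_mul0r ca_mulr0.
case dk: (k < d)%N; last by rewrite (point0 k) // ca_mul0r !ca_mulr0.
move: ij jk ik (leq_trans di d2) (leq_trans dj d2) (leq_trans dk d2); rewrite -!val_eqE /=.
by move: (val i) (val j) (val k) => /= [|[|?]] [|[|?]] [|[|?]].
Qed.

End Models.

Lemma Mat2_one_neq0 : ca_one <> ca_zero :> Mat2Cstar.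
Proof. by case=> /R1_neq_R0. Qed.

(** * The families of permutations attached to the nine spheres *)

Section Families.
Variables (N : nat) (A : CStarAlgebra) (x : 'I_N -> A) (tw : bool).

Definition fam_relP (E : permfam) : Prop := forall k (s : 'S_k), E k s -> sRrel x tw s.

Lemma fam_relP_S_infty : fam_relP S_infty <-> scommP x tw.
Proof.
split=> [h|sc k s _]; last exact: scomm_sRrel.
by apply: sRrel_scommP => k s; apply: h.
Qed.

Lemma fam_relP_S_infty_star : fam_relP S_infty_star <-> shcommP x tw.
Proof.
by split=> [|sc k s]; [exact: sRrel_shcommP | exact: shcomm_sRrel].
Qed.

Lemma fam_relP_triv_fam : fam_relP triv_fam <-> True.
Proof.
split=> // _ k s -> i; rewrite eps_count1 andbF; congr mono.
by apply: eq_map => r; rewrite perm1.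
Qed.

End Families.

Section Points.
Variables (N : nat) (N_ge3 : (3 <= N)%N) (tw : bool).

Lemma even_eps_point d k (s : 'S_k) : (0 < d)%N -> (d <= 3)%N ->
  sRrel (@point N d (~~ tw)) tw s ->
  forall i : 'I_k -> 'I_N, (forall u, (i u < d)%N) -> ~~ odd (eps_count s i).
Proof.
move=> d_gt0 d_le3 rs i id; pose L := [seq j : 'I_N <- enum 'I_N | (j < d)%N].
apply: (@even_eps_opposite_twist _ _ (point d (~~ tw)) tw L) => //.
- exact: Mat2_one_neq0.
- by move=> j; rewrite mem_filter => /andP[jd _]; apply: point_linv.
- exact: point_scomm.
- by move=> u; rewrite mem_filter id mem_enum.
Qed.

Let letter n (n3 : (n < 3)%N) : 'I_N := Ordinal (leq_trans n3 N_ge3).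

Lemma point2_S_infty_star k (s : 'S_k) :
  sRrel (@point N 2 (~~ tw)) tw s -> S_infty_star k s.
Proof.
move=> rs; apply: (@even_eps_S_infty_star N k s (@letter 0 isT) (@letter 1 isT)) => // i i2.
apply: (even_eps_point _ _ rs) => // u.
by have := i2 u; rewrite !inE => /orP[] /eqP ->.
Qed.

Lemma point3_triv_fam k (s : 'S_k) :
  sRrel (@point N 3 (~~ tw)) tw s -> triv_fam k s.
Proof.
move=> rs.
apply: (@even_eps_perm1 N k s (@letter 0 isT) (@letter 1 isT) (@letter 2 isT)) => // i i3.
apply: (even_eps_point _ _ rs) => // u.
by have := i3 u; rewrite !inE => /or3P[] /eqP ->.
Qed.

(** Polygonality yields half-commutation in both twists, which places this point in the spheres
    where the expected family is [S_infty_star]. *)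
Lemma point2_relations :
  let x := @point N 2 tw in
  [/\ sphereP x, scommP x tw, shcommP x tw & shcommP x (~~ tw)].
Proof.
have N2 := ltnW N_ge3; have sc := @point_scomm N 2 tw isT.
split=> //; [exact: point_sphere | exact: scommP_shcommP |].
by apply: shcommP_polyP; [exact: point_polyP | exact: scommP_shcommP].
Qed.

Lemma point3_relations :
  let x := @point N 3 tw in [/\ sphereP x, scommP x tw & shcommP x tw].
Proof.
have sc := @point_scomm N 3 tw isT.
by split=> //; [exact: point_sphere | exact: scommP_shcommP].
Qed.

End Points.

(** A polygonal condition is traded for a relation of the other twist; the nine cases then become
    propositional. *)
Lemma sph_spaceE N s (A : CStarAlgebra) (x : 'I_N -> A) :
  sph_space N s A x <->
  sphereP x /\ fam_relP x false (expG s) /\ fam_relP x true (expH s).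
Proof.
have c := fam_relP_S_infty x false; have ac := fam_relP_S_infty x true.
have h := fam_relP_S_infty_star x false; have bh := fam_relP_S_infty_star x true.
have t := fam_relP_triv_fam x false; have bt := fam_relP_triv_fam x true.
have act := scommP_true x; have bht := shcommP_true x.
have c_h := @scommP_shcommP _ _ x false; have ac_bh := @scommP_shcommP _ _ x true.
have p_h_bh := @shcommP_polyP _ _ x false; have p_bh_h := @shcommP_polyP _ _ x true.
have h_bh_p := @shcommP_both_polyP _ _ x.
have p_c_ac := @scommP_polyP _ _ x false.
have c_ac_p := @scommP_both_polyP _ _ x.
have cE : commP x <-> scommP x false by [].
have hE : hcommP x <-> shcommP x false by [].
case: s; cbn [sph_space expG expH];
  rewrite /S_plus /S_R_poly /S_star_poly /Sbar_R_poly /S_R /Sbar_R /S_star /Sbar_star.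
all: tauto.
Qed.

(** The test point of opposite twist lies in the sphere: two coordinates when [S_infty_star] is
    expected, three when [triv_fam] is. For [S_infty] there is nothing to prove. *)
Lemma expG_expH_max N s (tw : bool) k (p : 'S_k) : (3 <= N)%N ->
  (forall (A : CStarAlgebra) (x : 'I_N -> A), sph_space N s A x -> sRrel x tw p) ->
  (if tw then expH s else expG s) k p.
Proof.
move=> N3 Xp.
have [S2 sc2 sh2 sh2'] := point2_relations N3 (~~ tw).
have [S3 sc3 sh3] := point3_relations N3 (~~ tw).
have star : sph_space N s _ (@point N 2 (~~ tw)) -> S_infty_star k p.
  by move=> /Xp; apply: point2_S_infty_star.
have triv : sph_space N s _ (@point N 3 (~~ tw)) -> triv_fam k p.
  by move=> /Xp; apply: point3_triv_fam.
by case: tw s sc2 sh2 sh2' sc3 sh3 S2 S3 star triv {Xp} =>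
    -[] sc2 sh2 sh2' sc3 sh3 S2 S3 star triv //;
  cbn [expG expH] in *;
  (apply: star || apply: triv); apply/sph_spaceE; (split=> //; split);
  first [by apply/fam_relP_S_infty | by apply/fam_relP_S_infty_star | by apply/fam_relP_triv_fam].
Qed.

Theorem theorem1p6 (N : nat) : (3 <= N)%N ->
  forall s : sph,
    (forall k (p : 'S_k), Gfam N (sph_space N s) k p <-> expG s k p) /\
    (forall k (p : 'S_k), Hfam N (sph_space N s) k p <-> expH s k p) /\
    sub_eq N (sph_space N s)
           (cap_sub N (S_E N (Gfam N (sph_space N s))) (Sbar_E N (Hfam N (sph_space N s)))).
Proof.
move=> N3 s.
have G k (p : 'S_k) : Gfam N (sph_space N s) k p <-> expG s k p.
  split=> [|Ep A x Xx]; first exact: (@expG_expH_max N s false).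
  by have [_ [g _]] := iffLR (sph_spaceE _ _) Xx; exact: g.
have H k (p : 'S_k) : Hfam N (sph_space N s) k p <-> expH s k p.
  split=> [|Ep A x Xx]; first exact: (@expG_expH_max N s true).
  by have [_ [_ h]] := iffLR (sph_spaceE _ _) Xx; exact: h.
split=> //; split=> // A x; split=> [Xx|].
  have [Sx _] := iffLR (sph_spaceE _ _) Xx.
  by split; split=> // k p; [move=> Gp; apply: Gp | move=> Hp; apply: Hp].
(* By [G] and [H] the intersection imposes the relations of [expG s] and [expH s], which
   characterise the sphere. *)
move=> [[Sx g] [_ h]]; apply/sph_spaceE; split=> //; split=> k p Ep.
  exact/g/G.
exact/h/H.
Qed.
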